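(* There exists a continuous family $(Q_t)_{t\in I}$ ($I\subset\mathbb{R}$ an interval of positive length) of pairwise non-congruent $4$-simplices in $\mathbb{R}^{3,1}$ such that, for each of the ten 2-faces, the area of that 2-face of $Q_t$ is independent of $t$, and, for every $t\in I$, every 2-face of $Q_t$ is contained in a Euclidean plane.
   Context: For $0\le p\le n$, $\mathbb{R}^{p,n-p}$ is the $n$-dimensional real vector space with bilinear product $x\cdot y=x_1y_1+\cdots+x_py_p-x_{p+1}y_{p+1}-\cdots-x_ny_n$; write $u^2=u\cdot u$. An $n$-simplex in $\mathbb{R}^{p,n-p}$ is the convex hull of $n+1$ affinely independent (labeled) points; its $k$-faces are the $k$-simplices spanned by $k+1$ of its vertices. For a $k$-simplex $G$, choose a vertex as base point and let $u_1,\dots,u_k$ be the vectors from it to the other vertices; the $k$-volume of $G$ is $V_k(G)=|\det(u_i\cdot u_j)_{1\le i,j\le k}|^{1/2}/k!$ (independent of the base point). For $k=2$ it is called the area. A continuous family of $n$-simplices is a family indexed by a real interval whose vertices depend continuously on the parameter (faces at different parameters correspond via the vertex labels). Two simplices are congruent if an isometry of $\mathbb{R}^{p,n-p}$ maps one onto the other. A (2-dimensional affine) plane is a Euclidean plane if the restriction of the bilinear product to its direction space is positive definite. *)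

(* Defs.v *)
From HB Require Import structures.
From mathcomp Require Import all_boot all_order all_algebra.
From mathcomp Require Import all_classical all_reals all_analysis.

Set Implicit Arguments.
Unset Strict Implicit.
Unset Printing Implicit Defensive.

Import Order.TTheory GRing.Theory Num.Theory.
Import numFieldNormedType.Exports.
Local Open Scope classical_set_scope.
Local Open Scope ring_scope.

(* R^{p,n-p} is 'rV[R]_n with the product [dotp p], where p <= n. *)
Definition dotp {R : realType} {n : nat} (p : nat) (x y : 'rV[R]_n) : R :=
  \sum_(i < n | (i < p)%N) x 0 i * y 0 i -
  \sum_(i < n | (p <= i)%N) x 0 i * y 0 i.

Definition edge {R : realType} {n k : nat} (v : 'I_k.+1 -> 'rV[R]_n)
    (i : 'I_k) : 'rV[R]_n :=
  v (lift ord0 i) - v ord0.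

Definition affinely_independent {R : realType} {n k : nat}
    (v : 'I_k.+1 -> 'rV[R]_n) : bool :=
  free [tuple edge v i | i < k].

Definition conv_hull {R : realType} {n k : nat} (v : 'I_k.+1 -> 'rV[R]_n) :
    set 'rV[R]_n :=
  [set x | exists c : 'I_k.+1 -> R,
    [/\ forall i, 0 <= c i, \sum_i c i = 1 & x = \sum_i c i *: v i]].

Definition volume {R : realType} {n k : nat} (p : nat)
    (v : 'I_k.+1 -> 'rV[R]_n) : R :=
  Num.sqrt `|\det (\matrix_(i < k, j < k) dotp p (edge v i) (edge v j))|
    / k`!%:R.

Definition area {R : realType} {n : nat} (p : nat) (v : 'I_3 -> 'rV[R]_n) : R :=
  volume p v.

(* A choice of k+1 of the m+1 labels, listed in increasing order so that each
   k-face of an m-simplex v arises exactly once, as v \o s. *)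
Definition face_labels {k m : nat} (s : 'I_k.+1 -> 'I_m.+1) : Prop :=
  {homo s : i j / (i < j)%N}.

Definition isometry {R : realType} {n : nat} (p : nat)
    (f : 'rV[R]_n -> 'rV[R]_n) : Prop :=
  bijective f /\
  forall x y, dotp p (f x - f y) (f x - f y) = dotp p (x - y) (x - y).

(* The simplices are compared as subsets of the space, so an isometry may
   permute the vertex labels. *)
Definition congruent {R : realType} {n k : nat} (p : nat)
    (v w : 'I_k.+1 -> 'rV[R]_n) : Prop :=
  exists2 f, isometry p f & f @` conv_hull v = conv_hull w.

Definition euclidean_plane {R : realType} {n : nat} (p : nat)
    (P : set 'rV[R]_n) : Prop :=
  exists (a : 'rV[R]_n) (W : {vspace 'rV[R]_n}),
    [/\ \dim W = 2%N,
        P = [set a + w | w in [set w | w \in W]]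
      & forall w, w \in W -> w != 0 -> 0 < dotp p w w].

Definition continuous_simplex_family {R : realType} {n : nat} (I : set R)
    (Q : R -> 'I_n.+1 -> 'rV[R]_n) : Prop :=
  (forall t, I t -> affinely_independent (Q t)) /\
  (forall i, {within I, continuous (fun t => Q t i)}).

(* Main.v *)
Require Import Defs.
From mathcomp Require Import all_boot all_order all_algebra.
From mathcomp Require Import all_classical all_reals all_analysis.
From mathcomp Require Import ring lra.

Import Order.TTheory GRing.Theory Num.Theory.
Import numFieldNormedType.Exports.
Local Open Scope classical_set_scope.
Local Open Scope ring_scope.

(** Consider 4-simplices whose squared edge lengths are unchanged when the labels
1, 2 are exchanged and when 3, 4 are exchanged.  They have five parameters: let
a be the squared length of 01 and 02, b that of 03 and 04, c that of 12, d that
of 34, and e that of the four edges between 12 and 34.  With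
  heron x y z = 4 x y - (x + y - z)^2,
which is 16 times the squared area of a triangle with squared sides x, y, z, the
ten faces give only five conditions, namely that the quantities
  4 a c - c^2,  4 b d - d^2,  4 e c - c^2,  4 e d - d^2  and  heron a b e
are constant.  When the third and the fourth have the same value, d is a root of
d^2 - 4 e d + (4 e c - c^2) = 0, so that d = c or d = 4 e - c, and on the second
branch c d is constant; that branch is a curve parametrised by c.  The first two
conditions make a - e and b - e constant multiples of 1 / c and 1 / d, and
heron a b e becomes a Laurent polynomial in c with terms of degree 2, 0 and -2.
The coefficients of degree 2 and -2 are each a quadratic in one of the two free
multiples, and choosing the right root of each makes both vanish, so that all
ten areas are constant along the curve.

Up to scale, with c = 4 t^2, this gives a = t^2 + 4 / t^2, b = 4 t^2 + 1 / t^2,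
d = 4 / t^2 and e = t^2 + 1 / t^2 ([squared_edges]).  As 4 e = c + d, the
midpoints of 12 and 34 differ by a null vector orthogonal to both edges, which
forces the Lorentzian signature and leads to the coordinates in
[vertex_coordinates]; the simplex is nondegenerate for t > 1.  All edges have
positive square and all heron values are positive, so the faces span Euclidean
planes ([triangle_in_euclidean_plane]).

The simplices are told apart by their longest edge, of square 4 t^2 + 1 / t^2.
Since the form is indefinite and congruence compares convex hulls, one needs the
squared distance on the hull to be maximal at a pair of vertices.  This holds as
soon as all edges have nonnegative square ([sqdist_hull_le_edge]), because the
squared distance to a fixed point is then convex along every edge direction. *)

(** * The bilinear product *)

Section Product.
Context {R : realType} {n : nat} (p : nat).
Implicit Types (x y z : 'rV[R]_n) (a b : R).

Lemma dotpC x y : dotp p x y = dotp p y x.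
Proof. by congr (_ - _); apply: eq_bigr => i _; rewrite mulrC. Qed.

Lemma dotpDl x y z : dotp p (x + y) z = dotp p x z + dotp p y z.
Proof.
rewrite /dotp addrACA -opprD -!big_split /=.
by congr (_ - _); apply: eq_bigr => i _; rewrite mxE mulrDl.
Qed.

Lemma dotpZl a x y : dotp p (a *: x) y = a * dotp p x y.
Proof.
rewrite /dotp mulrBr !mulr_sumr.
by congr (_ - _); apply: eq_bigr => i _; rewrite mxE mulrA.
Qed.

Lemma dotpDr x y z : dotp p z (x + y) = dotp p z x + dotp p z y.
Proof. by rewrite !(dotpC z) dotpDl. Qed.

Lemma dotpZr a x y : dotp p x (a *: y) = a * dotp p x y.
Proof. by rewrite !(dotpC x) dotpZl. Qed.

Lemma dotpNl x y : dotp p (- x) y = - dotp p x y.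
Proof. by rewrite -scaleN1r dotpZl mulN1r. Qed.

Lemma dotpNr x y : dotp p x (- y) = - dotp p x y.
Proof. by rewrite -scaleN1r dotpZr mulN1r. Qed.

Lemma dotp0l y : dotp p 0 y = 0.
Proof. by rewrite -(scale0r y) dotpZl mul0r. Qed.

Lemma dotp_suml k (f : 'I_k -> 'rV[R]_n) y :
  dotp p (\sum_i f i) y = \sum_i dotp p (f i) y.
Proof.
by apply: (big_morph (fun x => dotp p x y)) => [x z|]; rewrite ?dotpDl ?dotp0l.
Qed.

Definition sqdist x y : R := dotp p (x - y) (x - y).

Lemma sqdistC x y : sqdist x y = sqdist y x.
Proof. by rewrite /sqdist -opprB dotpNl dotpNr opprK. Qed.

Lemma sqdistB x y z :
  sqdist (x - z) (y - z) = sqdist x y.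
Proof. by rewrite /sqdist opprB subrKA. Qed.

Lemma sqdistE x y : sqdist x y = dotp p x x - 2 * dotp p x y + dotp p y y.
Proof.
by rewrite /sqdist dotpDl !dotpDr !dotpNl !dotpNr (dotpC y x); ring.
Qed.

(** Leibniz's formula for the squared distance to a barycentre.  It is purely
bilinear, so it holds in every signature. *)
Lemma sqdist_barycenter k (v : 'I_k -> 'rV[R]_n) (c : 'I_k -> R) y :
  \sum_i c i = 1 ->
  sqdist (\sum_i c i *: v i) y = \sum_i c i * sqdist (v i) y
    - 2^-1 * \sum_i \sum_j c i * c j * sqdist (v i) (v j).
Proof.
move=> c1; pose w i := v i - y.
have vE i j : sqdist (v i) (v j) =
    dotp p (w i) (w i) - 2 * dotp p (w i) (w j) + dotp p (w j) (w j).
  by rewrite -sqdistE sqdistB.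
have -> : sqdist (\sum_i c i *: v i) y
          = \sum_i \sum_j c i * c j * dotp p (w i) (w j).
  have -> : sqdist (\sum_i c i *: v i) y
            = dotp p (\sum_i c i *: w i) (\sum_i c i *: w i).
    rewrite /sqdist; congr dotp; rewrite -[in LHS](scale1r y) -c1 scaler_suml;
      by rewrite -sumrB; apply: eq_bigr => i _; rewrite scalerBr.
  rewrite dotp_suml; apply: eq_bigr => i _.
  rewrite dotpC dotp_suml; apply: eq_bigr => j _.
  by rewrite dotpZl dotpZr dotpC; ring.
have -> : \sum_i c i * sqdist (v i) y
          = \sum_i \sum_j c i * c j * dotp p (w i) (w i).
  apply: eq_bigr => i _; rewrite -mulr_suml -mulr_sumr c1 mulr1.
  by [].
have swap : \sum_i \sum_j c i * c j * dotp p (w j) (w j)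
          = \sum_i \sum_j c i * c j * dotp p (w i) (w i).
  rewrite exchange_big /=; apply: eq_bigr => i _.
  by apply: eq_bigr => j _; rewrite (mulrC (c i)).
have -> : \sum_i \sum_j c i * c j * sqdist (v i) (v j)
    = \sum_i \sum_j c i * c j * dotp p (w i) (w i)
      - 2 * (\sum_i \sum_j c i * c j * dotp p (w i) (w j))
      + \sum_i \sum_j c i * c j * dotp p (w j) (w j).
  rewrite mulr_sumr -sumrB -big_split /=; apply: eq_bigr => i _.
  rewrite mulr_sumr -sumrB -big_split /=; apply: eq_bigr => j _.
  by rewrite vE; ring.
by rewrite swap; field.
Qed.

(** The correction term in Leibniz's formula is nonpositive when the edges have
nonnegative square; this replaces the convexity of the square, which fails for
an indefinite product. *)
Lemma sqdist_hull_le k (v : 'I_k.+1 -> 'rV[R]_n) M y x :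
  (forall i j, 0 <= sqdist (v i) (v j)) ->
  (forall i, sqdist (v i) y <= M) ->
  conv_hull v x -> sqdist x y <= M.
Proof.
move=> v_ge0 vM [c [c_ge0 c1 ->]]; rewrite sqdist_barycenter // lerBlDr.
have -> : M = \sum_i c i * M by rewrite -mulr_suml c1 mul1r.
apply: ler_wpDr; last by apply: ler_sum => i _; exact: ler_wpM2l.
rewrite mulr_ge0 ?invr_ge0 //; apply: sumr_ge0 => i _; apply: sumr_ge0 => j _.
by rewrite !mulr_ge0.
Qed.

Lemma sqdist_hull_le_edge k (v : 'I_k.+1 -> 'rV[R]_n) M x y :
  (forall i j, 0 <= sqdist (v i) (v j) <= M) ->
  conv_hull v x -> conv_hull v y -> sqdist x y <= M.
Proof.
move=> vM vx vy.
have v_ge0 i j : 0 <= sqdist (v i) (v j) by have /andP[] := vM i j.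
apply: (sqdist_hull_le _ _ _ _ _ v_ge0 _ vx) => i; rewrite sqdistC.
by apply: (sqdist_hull_le _ _ _ _ _ v_ge0 _ vy) => j; have /andP[] := vM j i.
Qed.

Lemma conv_hull_vertex k (v : 'I_k.+1 -> 'rV[R]_n) i : conv_hull v (v i).
Proof.
exists (fun j => (j == i)%:R); split=> [j||].
- by rewrite ler0n.
- by rewrite (bigD1 i) //= eqxx big1 ?addr0 // => j /negbTE->.
- rewrite (bigD1 i) //= eqxx scale1r big1 ?addr0 // => j /negbTE->.
  by rewrite scale0r.
Qed.

Lemma congruent_sym k (v w : 'I_k.+1 -> 'rV[R]_n) :
  congruent p v w -> congruent p w v.
Proof.
move=> [f [[g fK gK] f_iso] fvw]; exists g; first split; first by exists f.
  by move=> x y; rewrite -[in RHS](gK x) -[in RHS](gK y) f_iso.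
rewrite -fvw; apply/seteqP; split=> [_ [_ [x vx <-] <-]|x vx].
  by rewrite fK.
by exists (f x); rewrite ?fK //; exists x.
Qed.

(** The isometry need not send vertices to vertices here: it is enough that the
preimages of the vertices of [w] lie in the hull of [v]. *)
Lemma congruent_sqdist_le k (v w : 'I_k.+1 -> 'rV[R]_n) M :
  congruent p v w ->
  (forall i j, 0 <= sqdist (v i) (v j) <= M) ->
  forall i j, sqdist (w i) (w j) <= M.
Proof.
move=> [f [_ f_iso] fvw] vM i j.
have := conv_hull_vertex _ w i; rewrite -fvw => -[x vx <-].
have := conv_hull_vertex _ w j; rewrite -fvw => -[y vy <-].
by rewrite /sqdist f_iso; exact: (sqdist_hull_le_edge _ _ _ _ _ vM vx vy).
Qed.

End Product.

(** * Triangles *)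

Section Triangles.
Context {R : realType} {n : nat} (p : nat).
Implicit Types (u v : 'rV[R]_n) (w : 'I_3 -> 'rV[R]_n).

(** Heron's formula: 16 times the squared area of a triangle, in terms of its
squared sides. *)
Definition heron (a b c : R) : R := 4 * a * b - (a + b - c) ^+ 2.

Definition triangle_heron w : R :=
  heron (sqdist p (w 0) (w 1)) (sqdist p (w 0) (w 2)) (sqdist p (w 1) (w 2)).

Lemma gram_heron w :
  4 * (dotp p (w 1 - w 0) (w 1 - w 0) * dotp p (w 2 - w 0) (w 2 - w 0)
       - dotp p (w 1 - w 0) (w 2 - w 0) ^+ 2) = triangle_heron w.
Proof.
rewrite /triangle_heron /heron !(sqdistC p (w 0)) -(sqdistB p (w 1) (w 2) (w 0)).
by rewrite (sqdistE p (w 1 - w 0)) /sqdist; ring.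
Qed.

Lemma area_heron w : area p w = Num.sqrt `|triangle_heron w / 4| / 2`!%:R.
Proof.
rewrite /area /volume -gram_heron; congr (Num.sqrt `| _ | / _).
have l0 : lift ord0 (0 : 'I_2) = 1 :> 'I_3 by apply: val_inj.
have l1 : lift ord0 (1 : 'I_2) = 2 :> 'I_3 by apply: val_inj.
rewrite (expand_det_row _ 0) 2!big_ord_recl big_ord0 /cofactor !det_mx11 !mxE /=.
rewrite /edge.
have -> : lift 0 ord0 = 1 :> 'I_2 by apply: val_inj.
have -> : lift 1 0 = 0 :> 'I_2 by apply: val_inj.
rewrite !l0 !l1 /=.
by rewrite (dotpC p (w 2 - _) (w 1 - _)) -?[ord0]/(0 : 'I_3) /bump /=; field.
Qed.

(** Sylvester's criterion in dimension 2.  Stating it for a nonpositive value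
gives at once the independence of [u] and [v] and the positivity on their
span. *)
Lemma posdef_plane u v (x y : R) :
  0 < dotp p u u -> 0 < dotp p u u * dotp p v v - dotp p u v ^+ 2 ->
  dotp p (x *: u + y *: v) (x *: u + y *: v) <= 0 -> x = 0 /\ y = 0.
Proof.
move=> u_gt0 det_gt0.
rewrite dotpDl !dotpDr !dotpZl !dotpZr (dotpC p v u).
move: (dotp p u u) (dotp p v v) (dotp p u v) u_gt0 det_gt0 => a b c a0 d0 le0.
(* completing the square *)
have key : a * (x * (x * a) + x * (y * c) + (y * (x * c) + y * (y * b)))
    = (a * x + c * y) ^+ 2 + (a * b - c ^+ 2) * y ^+ 2 by ring.
have sum_le0 : (a * x + c * y) ^+ 2 + (a * b - c ^+ 2) * y ^+ 2 <= 0.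
  by rewrite -key pmulr_rle0.
have y0 : y = 0.
  apply/eqP; rewrite -sqrf_eq0 eq_le sqr_ge0 andbT -(pmulr_rle0 _ d0).
  by apply: le_trans sum_le0; rewrite lerDr sqr_ge0.
split=> //; move: sum_le0; rewrite y0 mulr0 addr0 expr0n mulr0 addr0 => ax.
have : (a * x) ^+ 2 == 0 by rewrite eq_le ax sqr_ge0.
by rewrite sqrf_eq0 mulf_eq0 gt_eqF //= => /eqP.
Qed.

Lemma triangle_in_euclidean_plane w :
  0 < sqdist p (w 0) (w 1) -> 0 < triangle_heron w ->
  exists2 P, euclidean_plane p P & conv_hull w `<=` P.
Proof.
rewrite sqdistC /sqdist -gram_heron pmulr_rgt0 // => u_gt0 det_gt0.
set u := w 1 - w 0 in u_gt0 det_gt0; set v := w 2 - w 0 in det_gt0.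
have defW z : z \in <<[:: u; v]>>%VS -> exists x y, z = x *: u + y *: v.
  rewrite span_cons span_seq1 => /memv_addP[_ /vlineP[x ->] [_ /vlineP[y ->] ->]].
  by exists x, y.
have uv_free : free (in_tuple [:: u; v]).
  apply/freeP => k.
  rewrite !big_ord_recl big_ord0 /= addr0 => k0.
  have [k00 k10] : k ord0 = 0 /\ k (lift ord0 ord0) = 0.
    by apply: (posdef_plane u v) => //; rewrite k0 dotp0l.
  by move=> i; case: (unliftP ord0 i) => [j|] -> //; rewrite ord1.
exists [set w 0 + z | z in [set z | z \in <<[:: u; v]>>%VS]].
  exists (w 0), <<[:: u; v]>>%VS; split=> // [|z /defW[x [y ->]]].
    by move: uv_free; rewrite /free => /eqP.
  rewrite ltNge; apply: contraNN => /(posdef_plane u v _ _ u_gt0 det_gt0)[-> ->].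
  by rewrite !scale0r addr0.
move=> _ [c [_ c1 ->]].
have -> : \sum_i c i *: w i = w 0 + (c 1 *: u + c 2 *: v).
  have : c 0 = 1 - c 1 - c 2.
    rewrite -c1 !big_ord_recl big_ord0.
    have -> : lift ord0 ord0 = 1 :> 'I_3 by apply: val_inj.
    have -> : lift ord0 (lift ord0 ord0) = 2 :> 'I_3 by apply: val_inj.
    by rewrite -[ord0]/(0 : 'I_3); ring.
  rewrite !big_ord_recl big_ord0.
  have -> : lift ord0 ord0 = 1 :> 'I_3 by apply: val_inj.
  have -> : lift ord0 (lift ord0 ord0) = 2 :> 'I_3 by apply: val_inj.
  rewrite -[ord0]/(0 : 'I_3) => ->; apply/rowP => j; rewrite !mxE; ring.
exists (c 1 *: u + c 2 *: v) => //=.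
by rewrite span_cons span_seq1 memv_add // memvZ ?memv_line.
Qed.

End Triangles.

(** * The family *)

Section Family.
Context {R : realType}.
Implicit Types (t : R) (i j k : 'I_5).

(** The edge 12 lies on the first axis and 34 is parallel to the second.  Their
midpoints differ by the null vector (0, 0, m, m); its size m is what makes the
squared length of 03 and 04 equal to 4 t^2 + 1 / t^2. *)
Definition vertex_coordinates t : seq (seq R) :=
  let m := t^-1 - t ^+ 3 in
  [:: [:: 0;   0;      2 / t; 0];
      [:: t;   0;      0;     0];
      [:: - t; 0;      0;     0];
      [:: 0;   t^-1;   m;     m];
      [:: 0;   - t^-1; m;     m]].

Definition vertex t i : 'rV[R]_4 :=
  \row_(j < 4) nth 0 (nth [::] (vertex_coordinates t) i) j.

Definition squared_edges t : seq (seq R) :=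
  let a := t ^+ 2 + 4 / t ^+ 2 in
  let b := 4 * t ^+ 2 + 1 / t ^+ 2 in
  let c := 4 * t ^+ 2 in
  let d := 4 / t ^+ 2 in
  let e := t ^+ 2 + 1 / t ^+ 2 in
  [:: [:: 0; a; a; b; b];
      [:: a; 0; c; e; e];
      [:: a; c; 0; e; e];
      [:: b; e; e; 0; d];
      [:: b; e; e; d; 0]].

Definition squared_edge t i j : R := nth 0 (nth [::] (squared_edges t) i) j.

Lemma ord5P (P : 'I_5 -> Prop) :
  P 0 -> P 1 -> P 2 -> P 3 -> P 4 -> forall i, P i.
Proof.
move=> P0 P1 P2 P3 P4 [m m5].
by case: m m5 => [|[|[|[|[|]]]]] // m5; [move: P0|move: P1|move: P2|move: P3|move: P4];
  congr P; apply: val_inj.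
Qed.

Lemma dotp3E (x y : 'rV[R]_4) :
  dotp 3 x y = x 0 0 * y 0 0 + x 0 1 * y 0 1 + x 0 2 * y 0 2 - x 0 3 * y 0 3.
Proof.
rewrite /dotp big_mkcond [X in _ - X]big_mkcond !big_ord_recl !big_ord0 /= !addr0 !add0r.
have -> : lift ord0 ord0 = 1 :> 'I_4 by apply: val_inj.
have -> : lift ord0 (lift ord0 ord0) = 2 :> 'I_4 by apply: val_inj.
have -> : lift ord0 (lift ord0 (lift ord0 ord0)) = 3 :> 'I_4 by apply: val_inj.
by rewrite -[ord0]/(0 : 'I_4) !addrA.
Qed.

Lemma sqdist_vertex t i j :
  t != 0 -> sqdist 3 (vertex t i) (vertex t j) = squared_edge t i j.
Proof.
move=> t0; rewrite /sqdist dotp3E !mxE /squared_edge.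
by elim/ord5P: i => /=; elim/ord5P: j => /=; field.
Qed.

(** For i < j < k, the value 64 is taken by the faces 012 and 034, which join the
apex to one of the edges 12 and 34. *)
Definition face_heron i j k : R :=
  if i == 0 then if odd j && (val k == j.+1) then 64 else 36 else 16.

(** The constancy of the ten areas: t cancels out of each of the ten Heron
expressions. *)
Lemma heron_squared_edge t i j k : t != 0 -> (i < j < k)%N ->
  heron (squared_edge t i j) (squared_edge t i k) (squared_edge t j k)
    = face_heron i j k.
Proof.
move=> t0; rewrite /squared_edge /face_heron /heron.
elim/ord5P: i => /=; elim/ord5P: j => //=; elim/ord5P: k => //= _; by field.
Qed.

Lemma squared_edge_gt0 t i j : 0 < t -> i != j -> 0 < squared_edge t i j.
Proof.
move=> t0; rewrite /squared_edge.
have u0 : 0 < t ^+ 2 by rewrite exprn_gt0.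
have v0 : 0 < (t ^+ 2)^-1 by rewrite invr_gt0.
by elim/ord5P: i => /=; elim/ord5P: j => //= _; lra.
Qed.

Lemma squared_edge_le t i j : 1 < t ->
  0 <= squared_edge t i j <= 4 * t ^+ 2 + 1 / t ^+ 2.
Proof.
move=> t1; rewrite /squared_edge.
have u0 : 1 < t ^+ 2 by rewrite exprn_egt1 // gt_eqF.
have v0 : 0 < (t ^+ 2)^-1 by rewrite invr_gt0 (lt_trans _ u0).
have v1 : (t ^+ 2)^-1 < 1 by rewrite invf_lt1 // (lt_trans _ u0).
by elim/ord5P: i => /=; elim/ord5P: j => /=; apply/andP; split; lra.
Qed.

Lemma longest_edge_mono s t : 1 < s -> s < t ->
  4 * s ^+ 2 + 1 / s ^+ 2 < 4 * t ^+ 2 + 1 / t ^+ 2.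
Proof.
move=> s1 st.
have s2 : 1 < s ^+ 2 by rewrite exprn_egt1 // gt_eqF.
have st2 : s ^+ 2 < t ^+ 2 by rewrite ltr_pXn2r // nnegrE; lra.
move: (s ^+ 2) (t ^+ 2) s2 st2 => {s1 st}a b a1 ab.
rewrite -subr_gt0.
(* x |-> 4 x + 1 / x has slope at least 3 beyond 1 *)
have -> : 4 * b + 1 / b - (4 * a + 1 / a) = (b - a) * (4 - (a * b)^-1).
  by field; rewrite !gt_eqF //; lra.
have ab1 : 1 < a * b by rewrite mulr_egt1 //; lra.
have : (a * b)^-1 < 1 by rewrite invf_lt1 //; lra.
by move=> h; rewrite mulr_gt0 //; lra.
Qed.

Lemma vertex_affinely_independent t :
  1 < t -> affinely_independent (vertex t).
Proof.
move=> t1; have t0 : t != 0 by rewrite gt_eqF // (lt_trans _ t1).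
(* the edges 12 and 34 become coplanar when t = 1 *)
have m0 : t^-1 - t ^+ 3 != 0.
  rewrite lt_eqF // subr_lt0 (@lt_trans _ _ 1) //; first by rewrite invf_lt1; lra.
  by rewrite exprn_egt1.
apply/freeP => c; rewrite !big_ord_recl big_ord0 addr0 -!tnth_nth !tnth_mktuple.
move=> /rowP c0; move: (c0 0) (c0 1) (c0 2) (c0 3).
rewrite !mxE /=.
suff coef0 (a b d e : R) :
    a * (t - 0) + (b * (- t - 0) + (d * (0 - 0) + e * (0 - 0))) = 0 ->
    a * (0 - 0) + (b * (0 - 0) + (d * (t^-1 - 0) + e * (- t^-1 - 0))) = 0 ->
    a * (0 - 2 / t) + (b * (0 - 2 / t)
      + (d * (t^-1 - t ^+ 3 - 2 / t) + e * (t^-1 - t ^+ 3 - 2 / t))) = 0 ->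
    a * (0 - 0) + (b * (0 - 0)
      + (d * (t^-1 - t ^+ 3 - 0) + e * (t^-1 - t ^+ 3 - 0))) = 0 ->
    [/\ a = 0, b = 0, d = 0 & e = 0].
  move=> h0 h1 h2 h3; have [? ? ? ?] := coef0 _ _ _ _ h0 h1 h2 h3.
  move=> l; case: (unliftP ord0 l) => [l1 ->|->] //.
  case: (unliftP ord0 l1) => [l2 ->|->] //.
  by case: (unliftP ord0 l2) => [l3 ->|->] //; rewrite (ord1 l3).
move=> h0 h1 h2 h3.
have ab : a = b by apply: (mulfI t0); lra.
have de : d = e by apply: (mulfI (invr_neq0 t0)); lra.
have d0 : d = 0 by apply: (mulfI m0); move: h3; rewrite -de; lra.
have a0 : a = 0.
  by apply: (mulfI (invr_neq0 t0)); move: h2; rewrite -de d0 -ab; lra.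
by rewrite -de -ab d0 a0.
Qed.

(** Expanding along the standard basis reduces continuity to the coordinates. *)
Lemma continuous_row {T : topologicalType} {n : nat} (f : T -> 'rV[R]_n) x :
  (forall l, {for x, continuous (fun s => f s 0 l)}) -> {for x, continuous f}.
Proof.
move=> cf; rewrite /continuous_at.
have -> : f = (fun s => \sum_l f s 0 l *: delta_mx 0 l).
  by apply/funext => s; rewrite -row_sum_delta.
apply: cvg_big => [|l _]; first exact: add_continuous.
by apply: cvgZr_tmp; exact: cf.
Qed.

Lemma vertex_continuous t i : t != 0 -> {for t, continuous (vertex ^~ i)}.
Proof.
move=> t0; apply: continuous_row => l.
have ctV : {for t, continuous (fun s : R => s^-1)} by exact: inv_continuous t0.
have ct : {for t, continuous (fun s : R => s)} by [].
have ct3 : {for t, continuous (fun s : R => s ^+ 3)} by apply: exprn_continuous.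
have ctc (c : R) : {for t, continuous (fun s : R => c)} by exact: cst_continuous.
have -> : (fun s => vertex s i 0 l)
          = (fun s => nth 0 (nth [::] (vertex_coordinates s) i) l).
  by apply/funext => s; rewrite mxE.
case: l => -[|[|[|[|]]]] // ? /=; elim/ord5P: i => //=;
 do ?[exact: ctc | exact: ctV | exact: cvgN | apply: cvgB => // | apply: cvgM => //].
Qed.

End Family.

Theorem theorem1p2 (R : realType) :
  exists (I : set R) (Q : R -> 'I_5 -> 'rV[R]_4),
    [/\ is_interval I /\ (exists a b, [/\ I a, I b & a < b]),
        continuous_simplex_family I Q,
        (forall s t, I s -> I t -> s <> t -> ~ congruent 3 (Q s) (Q t)),
        (forall F : 'I_3 -> 'I_5, face_labels F ->
          forall s t, I s -> I t -> area 3 (Q s \o F) = area 3 (Q t \o F))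
      & (forall t, I t -> forall F : 'I_3 -> 'I_5, face_labels F ->
          exists2 P, euclidean_plane 3 P & conv_hull (Q t \o F) `<=` P)].
Proof.
have tn0 t : 1 < t -> t != 0 :> R by move=> t1; rewrite gt_eqF // (lt_trans _ t1).
have heronF (F : 'I_3 -> 'I_5) (t : R) : face_labels F -> 1 < t ->
    triangle_heron 3 (vertex t \o F) = face_heron (F 0) (F 1) (F 2).
  move=> incF t1; rewrite /triangle_heron /= !sqdist_vertex ?tn0 //.
  by rewrite heron_squared_edge ?tn0 // !incF.
exists [set t | 1 < t], vertex; split.
- split; last by exists 2, 3; split=> /=; lra.
  by move=> x y /= x1 y1 z /andP[xz _]; exact: lt_le_trans x1 xz.
- split=> [t|i]; first exact: vertex_affinely_independent.
  apply: continuous_in_subspaceT => t /set_mem /= t1.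
  by apply: vertex_continuous; exact: tn0.
- have noncongr (s t : R) : 1 < s -> s < t -> ~ congruent 3 (vertex s) (vertex t).
    move=> s1 st cong_st; have t1 := lt_trans s1 st.
    have : sqdist 3 (vertex t 0) (vertex t 3) <= 4 * s ^+ 2 + 1 / s ^+ 2.
      apply: (congruent_sqdist_le _ _ _ _ _ cong_st) => i j.
      by rewrite sqdist_vertex ?tn0 // squared_edge_le.
    by rewrite sqdist_vertex ?tn0 // leNgt longest_edge_mono.
  move=> s t s1 t1 /eqP; rewrite neq_lt => /orP[st|ts]; first exact: noncongr.
  by move/congruent_sym; exact: noncongr.
- by move=> F incF s t s1 t1; rewrite !area_heron !heronF.
- move=> t t1 F incF; apply: triangle_in_euclidean_plane.
    rewrite /= sqdist_vertex ?tn0 // squared_edge_gt0 ?(lt_trans _ t1) //.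
    by rewrite -val_eqE ltn_eqF // incF.
  by rewrite heronF // /face_heron; do 2?case: ifP => _.
Qed.
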